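(* Let $\theta^0,\theta^\infty_1,\theta^\infty_2,\theta^\infty_3\in\mathbb{C}$ with $2\theta^0+2\theta^\infty_1+\theta^\infty_2+\theta^\infty_3=0$, $\theta^0\neq0$ and $\theta^\infty_2\ne\theta^\infty_3$. Let $q_1,p_1,q_2,p_2,v$ be holomorphic functions of $t$ and $U$ a holomorphic $2\times2$-matrix function of $t$ on a domain of $\mathbb{C}$, with $v\ne0$ and $\det U\neq0$. Put $$Q=\begin{pmatrix} q_1&1\\ -q_2&q_1\end{pmatrix},\quad P=\begin{pmatrix} p_1/2&-p_2\\ p_2q_2-\theta^0-\theta^\infty_1-\theta^\infty_2&p_1/2\end{pmatrix},\quad \Theta=\begin{pmatrix}\theta^\infty_2&0\\ 0&\theta^\infty_3\end{pmatrix},\quad G=\mathrm{diag}(1,v)\oplus U,$$ and in $2\times2$ blocks (with $I=I_2$) $$\hat A_\infty^{(-2)}=\begin{pmatrix}O&O\\ O&-I\end{pmatrix},\quad \hat A_\infty^{(-1)}=\begin{pmatrix}O&PQ-\Theta\\ I&tI\end{pmatrix},\quad \hat A_0^{(0)}=\begin{pmatrix}-P\\ I\end{pmatrix}\begin{pmatrix}Q&QP+\theta^0I\end{pmatrix},\quad \hat B_1=\begin{pmatrix}O&-(PQ-\Theta)\\ -I&O\end{pmatrix}.$$ Consider the linear systems $$\frac{\partial Y}{\partial x}=AY,\quad A=G^{-1}\left(\hat A_\infty^{(-2)}x+\hat A_\infty^{(-1)}+\frac{\hat A_0^{(0)}}{x}\right)G,\qquad \frac{\partial Y}{\partial t}=BY,\quad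 B=\begin{pmatrix}O&O\\ O&I\end{pmatrix}x+G^{-1}\hat B_1G .$$ Then the compatibility condition $\partial_tA-\partial_xB+[A,B]=O$ (for all $x$) is equivalent to the Hamiltonian system $$\frac{dq_i}{dt}=\frac{\partial H}{\partial p_i},\quad \frac{dp_i}{dt}=-\frac{\partial H}{\partial q_i}\ (i=1,2),\qquad H=\mathrm{tr}\left[QP(P-Q-tI)+\theta^0P-(\theta^0+\theta^\infty_1)Q\right],$$ together with $$\frac{dU}{dt}=\begin{pmatrix}-q_1-t&-1\\ q_2&p_1-(2p_2+3)q_1-2t\end{pmatrix}U,\qquad \frac1v\frac{dv}{dt}=p_1-2(p_2+1)q_1-t .$$
   Context: This is the fourth matrix Painlevé system $H^{\mathrm{Mat}}_{\mathrm{IV}}$, attached to linear systems with a regular singularity at $x=0$ and an irregular singularity at $x=\infty$, of spectral type $((2))((11)),22$. $H$ is regarded as a polynomial in $q_1,p_1,q_2,p_2,t$ by inserting the displayed matrices. $\oplus$ denotes block-diagonal sum. *)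

(* Defs.v *)
From HB Require Import structures.
From mathcomp Require Import all_boot all_order all_algebra.
From mathcomp Require Import complex.
From mathcomp Require Import boolp classical_sets reals topology normedtype derive.

Set Implicit Arguments.
Unset Strict Implicit.
Unset Printing Implicit Defensive.

Import Order.TTheory GRing.Theory Num.Theory.
Import numFieldNormedType.Exports.

Local Open Scope ring_scope.
Local Open Scope classical_set_scope.

(* R[i] packaged as a numFieldType, so that its canonical topology and
   normed-module structure over itself (hence complex differentiation:
   derivable f z 1 and derive1) are inferred. *)
Definition Cplx (R : realType) : numFieldType := R[i].

Definition complex_domain (C : numFieldType) (D : set C) : Prop :=
  [/\ open D, connected D & D !=set0].

(* Functions are total; only their values on the open set D matter here. *)
Definition holomorphic_on (C : numFieldType) (D : set C) (f : C -> C) : Prop :=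
  forall t, D t -> derivable f t 1.

Definition holomorphic_mx_on (C : numFieldType) (m n : nat) (D : set C)
    (F : C -> 'M[C]_(m, n)) : Prop :=
  forall i j, holomorphic_on D (fun t => F t i j).

Definition derive_mx1 (C : numFieldType) (m n : nat) (F : C -> 'M[C]_(m, n))
    (t : C) : 'M[C]_(m, n) :=
  \matrix_(i, j) derive1 (fun s : C => F s i j) t.

Section MatrixPIV.
Context {C : numFieldType}.
Implicit Types (a b c d th q p v t x : C) (U : 'M[C]_2).

Definition mx2 a b c d : 'M[C]_2 :=
  \matrix_(i, j) if i == 0 then (if j == 0 then a else b)
                 else (if j == 0 then c else d).

Definition Qmx q1 q2 : 'M[C]_2 := mx2 q1 1 (- q2) q1.

Definition Pmx th0 th1 th2 p1 q2 p2 : 'M[C]_2 :=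
  mx2 (p1 / 2) (- p2) (p2 * q2 - th0 - th1 - th2) (p1 / 2).

Definition Theta th2 th3 : 'M[C]_2 := mx2 th2 0 0 th3.

Definition gauge v U : 'M[C]_(2 + 2) := block_mx (mx2 1 0 0 v) 0 0 U.

Definition Ahat_infty2 : 'M[C]_(2 + 2) := block_mx 0 0 0 (- 1%:M).

Definition Ahat_infty1 th0 th1 th2 th3 q1 p1 q2 p2 t : 'M[C]_(2 + 2) :=
  let Q := Qmx q1 q2 in let P := Pmx th0 th1 th2 p1 q2 p2 in
  block_mx 0 (P *m Q - Theta th2 th3) 1%:M t%:M.

Definition Ahat_0 th0 th1 th2 q1 p1 q2 p2 : 'M[C]_(2 + 2) :=
  let Q := Qmx q1 q2 in let P := Pmx th0 th1 th2 p1 q2 p2 in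
  col_mx (- P) 1%:M *m row_mx Q (Q *m P + th0%:M).

Definition Bhat_1 th0 th1 th2 th3 q1 p1 q2 p2 : 'M[C]_(2 + 2) :=
  let Q := Qmx q1 q2 in let P := Pmx th0 th1 th2 p1 q2 p2 in
  block_mx 0 (- (P *m Q - Theta th2 th3)) (- 1%:M) 0.

Definition Amx th0 th1 th2 th3 q1 p1 q2 p2 v U t x : 'M[C]_(2 + 2) :=
  invmx (gauge v U)
  *m (x *: Ahat_infty2 + Ahat_infty1 th0 th1 th2 th3 q1 p1 q2 p2 t
      + x^-1 *: Ahat_0 th0 th1 th2 q1 p1 q2 p2)
  *m gauge v U.

Definition Bmx th0 th1 th2 th3 q1 p1 q2 p2 v U x : 'M[C]_(2 + 2) :=
  x *: block_mx 0 0 0 1%:M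
  + invmx (gauge v U) *m Bhat_1 th0 th1 th2 th3 q1 p1 q2 p2 *m gauge v U.

Definition Ham th0 th1 th2 q1 p1 q2 p2 t : C :=
  let Q := Qmx q1 q2 in let P := Pmx th0 th1 th2 p1 q2 p2 in
  \tr (Q *m P *m (P - Q - t%:M) + th0 *: P - (th0 + th1) *: Q).

End MatrixPIV.

(* A and B take the spectral variable x first, then the deformation parameter t. *)
Definition compatible_at (C : numFieldType) (n : nat)
    (A B : C -> C -> 'M[C]_n) (x t : C) : Prop :=
  derive_mx1 (fun s => A x s) t - derive_mx1 (fun y => B y t) x
  + (A x t *m B x t - B x t *m A x t) = 0.

(* Main.v *)
Require Import Defs.
From HB Require Import structures.
From mathcomp Require Import all_boot all_order all_algebra.
From mathcomp Require Import complex.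
From mathcomp Require Import ring.
From mathcomp Require Import boolp classical_sets functions reals topology normedtype derive.

Set Implicit Arguments.
Unset Strict Implicit.
Unset Printing Implicit Defensive.

Import Order.TTheory GRing.Theory Num.Theory.
Import numFieldNormedType.Exports.

Local Open Scope ring_scope.
Local Open Scope classical_set_scope.

(** Write W = G' G^-1, which is block diagonal with blocks W1 = diag(0, v'/v) and
W2 = U' U^-1. Since G commutes with E = diag(O, I), conjugating the compatibility
condition by G turns it into
  d/dt Ahat - E + [Ahat, x E + Z] = 0,   Z = Bhat_1 + W,
in which G survives only through W. The powers x^2 and x^1 cancel identically, so
for all x <> 0 the condition says that the coefficients of x^0 and of x^-1 vanish
([curvature_expansion]).

With M = P Q - Theta, the coefficient of x^0 contains W2 = W1 - Q - t. The residue at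
x = 0 is a product L R of L = (-P; I) and R = (Q, Q P + th0), and R L = th0. As th0 is
nonzero, R is right invertible, so the coefficient of x^-1 can be split into one
equation for R' and one for P' ([pole_part_eq0]). After this the equations for
(P Q)' and (Q P)' follow from those for P' and Q', and what is left is
  W2 = W1 - Q - t,
  Q' = P Q + Q P - Q^2 - t Q + th0 + [W1, Q],
  P' = 2 P Q - P^2 - Theta + t P + [W1, P]
([zero_curvature_blocks], valid for blocks of any size).

For the given 2 x 2 blocks, [P, Q] = diag(k, -k) with k = th0 + th1 + th2, and the
relation between the exponents gives 2 P Q - Theta = P Q + Q P + th0 + th1. The
(1,2) entry of the equation for Q' determines v'/v, because the corresponding entry
of Q is the constant 1; the other entries are the Hamiltonian system
([matrix_hamilton_equations]). The equation for W2 then becomes the one for U. *)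

(** * Differentiation of matrix functions *)

Section MatrixCalculus.
Context {C : numFieldType}.

(** Unlike [derive_mx1], this carries the differentiability of the entries, so that it
composes under sums, products and blocks. *)
Definition is_derive_mx m n (F : C -> 'M[C]_(m, n)) (t : C) (F' : 'M[C]_(m, n)) :=
  forall i j, is_derive t 1 (fun s => F s i j) (F' i j).

Lemma is_derive_mx_val m n (F : C -> 'M[C]_(m, n)) t F' :
  is_derive_mx F t F' -> derive_mx1 F t = F'.
Proof.
by move=> dF; apply/matrixP => i j; rewrite mxE derive1E; have [_ ->] := dF i j.
Qed.

Lemma derivable_is_derive (f : C -> C) (t : C) :
  derivable f t 1 -> is_derive t 1 f (derive1 f t).
Proof. by move=> df; rewrite derive1E; exact: derivableP. Qed.

Lemma is_derive_const (c t : C) : is_derive t 1 (fun=> c) 0.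
Proof. exact: (is_derive_cst c t 1). Qed.

Lemma derivable_is_derive_mx m n (F : C -> 'M[C]_(m, n)) (t : C) :
  (forall i j, derivable (fun s => F s i j) t 1) ->
  is_derive_mx F t (derive_mx1 F t).
Proof. by move=> dF i j; rewrite mxE; exact: derivable_is_derive. Qed.

Lemma near_is_derive_mx m n (F G : C -> 'M[C]_(m, n)) t F' :
  (\near t, F t = G t) -> is_derive_mx F t F' -> is_derive_mx G t F'.
Proof.
move=> FG dF i j; apply: near_eq_is_derive (dF i j).
by apply: filterS FG => s ->.
Qed.

Lemma is_derive_mx_cst m n (A : 'M[C]_(m, n)) t : is_derive_mx (fun=> A) t 0.
Proof. by move=> i j; rewrite mxE; exact: is_derive_cst. Qed.

Lemma is_derive_mxD m n (F G : C -> 'M[C]_(m, n)) t F' G' :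
  is_derive_mx F t F' -> is_derive_mx G t G' ->
  is_derive_mx (fun s => F s + G s) t (F' + G').
Proof.
move=> dF dG i j; rewrite mxE.
rewrite (_ : (fun s => _) = (fun s => F s i j) + (fun s => G s i j)).
  by apply: is_deriveD.
by apply/funext => s; rewrite mxE.
Qed.

Lemma is_derive_mxN m n (F : C -> 'M[C]_(m, n)) t F' :
  is_derive_mx F t F' -> is_derive_mx (fun s => - F s) t (- F').
Proof.
move=> dF i j; rewrite mxE.
rewrite (_ : (fun s => _) = - (fun s => F s i j)); first exact: is_deriveN.
by apply/funext => s; rewrite mxE.
Qed.

Lemma is_derive_mxZ m n (f : C -> C) (F : C -> 'M[C]_(m, n)) (t f' : C) F' :
  is_derive t 1 f f' -> is_derive_mx F t F' ->
  is_derive_mx (fun s => f s *: F s) t (f' *: F t + f t *: F').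
Proof.
move=> df dF i j; rewrite !mxE.
rewrite (_ : (fun s => _) = f * (fun s => F s i j)).
  apply: is_derive_eq; first exact: is_deriveM.
  by rewrite addrC; congr (_ + _); exact: mulrC.
by apply/funext => s; rewrite mxE.
Qed.

Lemma is_derive_scalar_mx n (t : C) : is_derive_mx (fun s => s%:M : 'M[C]_n) t 1%:M.
Proof.
have dE := is_derive_mxZ (is_derive_id t 1) (is_derive_mx_cst (1%:M : 'M[C]_n) t).
move: dE; rewrite scale1r scaler0 addr0.
by under [X in is_derive_mx X _ _ -> _]eq_fun do rewrite scalemx1.
Qed.

Lemma is_derive_mxM m n p (F : C -> 'M[C]_(m, n)) (G : C -> 'M[C]_(n, p)) t F' G' :
  is_derive_mx F t F' -> is_derive_mx G t G' ->
  is_derive_mx (fun s => F s *m G s) t (F' *m G t + F t *m G').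
Proof.
move=> dF dG i j.
rewrite (_ : (fun s => _) = \sum_k ((fun s => F s i k) * (fun s => G s k j))).
  apply: is_derive_eq.
    by apply: is_derive_sum => k; apply: is_deriveM.
  rewrite !mxE -big_split; apply: eq_bigr => k _.
  by rewrite addrC; congr (_ + _); exact: mulrC.
by apply/funext => s; rewrite mxE fct_sumE.
Qed.

Lemma is_derive_block m1 m2 n1 n2 t
    (F1 : C -> 'M[C]_(m1, n1)) (F2 : C -> 'M[C]_(m1, n2))
    (F3 : C -> 'M[C]_(m2, n1)) (F4 : C -> 'M[C]_(m2, n2)) F1' F2' F3' F4' :
  is_derive_mx F1 t F1' -> is_derive_mx F2 t F2' ->
  is_derive_mx F3 t F3' -> is_derive_mx F4 t F4' ->
  is_derive_mx (fun s => block_mx (F1 s) (F2 s) (F3 s) (F4 s)) t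
    (block_mx F1' F2' F3' F4').
Proof.
move=> d1 d2 d3 d4 i j; rewrite -(fintype.splitK i) -(fintype.splitK j).
case: (fintype.split i) => k; case: (fintype.split j) => l /=.
- rewrite block_mxEul; under eq_fun do rewrite block_mxEul; exact: d1.
- rewrite block_mxEur; under eq_fun do rewrite block_mxEur; exact: d2.
- rewrite block_mxEdl; under eq_fun do rewrite block_mxEdl; exact: d3.
- rewrite block_mxEdr; under eq_fun do rewrite block_mxEdr; exact: d4.
Qed.

Lemma is_derive_row m n1 n2 t (F : C -> 'M[C]_(m, n1)) (G : C -> 'M[C]_(m, n2)) F' G' :
  is_derive_mx F t F' -> is_derive_mx G t G' ->
  is_derive_mx (fun s => row_mx (F s) (G s)) t (row_mx F' G').
Proof.
move=> dF dG i j; rewrite -(fintype.splitK j); case: (fintype.split j) => l /=.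
- rewrite row_mxEl; under eq_fun do rewrite row_mxEl; exact: dF.
- rewrite row_mxEr; under eq_fun do rewrite row_mxEr; exact: dG.
Qed.

Lemma is_derive_col m1 m2 n t (F : C -> 'M[C]_(m1, n)) (G : C -> 'M[C]_(m2, n)) F' G' :
  is_derive_mx F t F' -> is_derive_mx G t G' ->
  is_derive_mx (fun s => col_mx (F s) (G s)) t (col_mx F' G').
Proof.
move=> dF dG i j; rewrite -(fintype.splitK i); case: (fintype.split i) => l /=.
- rewrite col_mxEu; under eq_fun do rewrite col_mxEu; exact: dF.
- rewrite col_mxEd; under eq_fun do rewrite col_mxEd; exact: dG.
Qed.

Lemma is_derive_mx2 (a b c d : C -> C) (t a' b' c' d' : C) :
  is_derive t 1 a a' -> is_derive t 1 b b' ->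
  is_derive t 1 c c' -> is_derive t 1 d d' ->
  is_derive_mx (fun s => mx2 (a s) (b s) (c s) (d s)) t (mx2 a' b' c' d').
Proof.
move=> da db dc dd i j; rewrite mxE; under eq_fun do rewrite mxE.
by case: (i == 0); case: (j == 0).
Qed.

Lemma derivable_bigsum (I : Type) (r : seq I) (f : I -> C -> C) (t : C) :
  (forall i, derivable (f i) t 1) -> derivable (fun s => \sum_(i <- r) f i s) t 1.
Proof.
move=> df; elim: r => [|i r IHr].
  by under eq_fun do rewrite big_nil; exact: derivable_cst.
under eq_fun do rewrite big_cons; exact: derivableD (df i) IHr.
Qed.

Lemma derivable_bigprod (I : Type) (r : seq I) (f : I -> C -> C) (t : C) :
  (forall i, derivable (f i) t 1) -> derivable (fun s => \prod_(i <- r) f i s) t 1.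
Proof.
move=> df; elim: r => [|i r IHr].
  by under eq_fun do rewrite big_nil; exact: derivable_cst.
under eq_fun do rewrite big_cons; exact: derivableM (df i) IHr.
Qed.

Lemma derivable_det n (F : C -> 'M[C]_n) (t : C) :
  (forall i j, derivable (fun s => F s i j) t 1) ->
  derivable (fun s => \det (F s)) t 1.
Proof.
move=> dF; apply: derivable_bigsum => sigma.
apply: derivableM; first exact: derivable_cst.
exact: derivable_bigprod.
Qed.

(** Near t the inverse is the adjugate divided by the determinant, and both are
polynomial in the entries. *)
Lemma derivable_invmx n (F : C -> 'M[C]_n) (t : C) :
  (forall i j, derivable (fun s => F s i j) t 1) ->
  (\near t, F t \in unitmx) ->
  forall i j, derivable (fun s => invmx (F s) i j) t 1.
Proof.
move=> dF uF i j.
have ut : \det (F t) != 0 by move: (nbhs_singleton uF); rewrite unitmxE unitfE.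
have dadj : derivable (fun s => (\adj (F s)) i j) t 1.
  under eq_fun do rewrite mxE.
  apply: derivableM; first exact: derivable_cst.
  apply: derivable_det => k l; under eq_fun do rewrite !mxE; exact: dF.
have dinv : derivable (fun s => (\det (F s))^-1) t 1.
  by apply: (@derivableV _ _ (fun s => \det (F s))); [exact: ut|exact: derivable_det].
have dVM : derivable (fun s => (\det (F s))^-1 * (\adj (F s)) i j) t 1.
  exact: derivableM.
apply: near_eq_derivable dVM.
by apply: filterS uF => s us; rewrite /invmx us [RHS]mxE.
Qed.

Lemma is_derive_invmx n (F : C -> 'M[C]_n) t F' :
  is_derive_mx F t F' -> (\near t, F t \in unitmx) ->
  is_derive_mx (fun s => invmx (F s)) t (- (invmx (F t) *m F' *m invmx (F t))).
Proof.
move=> dF uF; have ut := nbhs_singleton uF.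
have dI : is_derive_mx (fun s => invmx (F s)) t (derive_mx1 (fun s => invmx (F s)) t).
  apply/derivable_is_derive_mx/derivable_invmx => // i j.
  by have [] := dF i j.
suff <- : derive_mx1 (fun s => invmx (F s)) t = - (invmx (F t) *m F' *m invmx (F t)) by [].
(* Differentiate F * F^-1 = 1. *)
have := is_derive_mx_val (is_derive_mxM dF dI).
rewrite (is_derive_mx_val (near_is_derive_mx _ (is_derive_mx_cst (1%:M : 'M[C]_n) t))).
  move/(congr1 (mulmx (invmx (F t)))); rewrite mulmxDr mulmx0 mulKmx // mulmxA => e.
  by apply/esym/eqP; rewrite eqr_oppLR -addr_eq0 -e.
by apply: filterS uF => s us; rewrite mulmxV.
Qed.

End MatrixCalculus.

(** The source of the commutator with W = G' G^-1: it is the contribution of the two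
outer factors, and the hypothesis on G avoids writing its inverse. *)
Lemma is_derive_conjmx (C : numFieldType) n (F G : C -> 'M[C]_n) (t : C) F' W :
  is_derive_mx F t F' -> is_derive_mx G t (W *m G t) ->
  (\near t, G t \in unitmx) ->
  is_derive_mx (fun s => invmx (G s) *m F s *m G s) t
    (invmx (G t) *m (F' + (F t *m W - W *m F t)) *m G t).
Proof.
move=> dF dG uG; have ut := nbhs_singleton uG.
have := is_derive_mxM (is_derive_mxM (is_derive_invmx dG uG) dF) dG.
by rewrite !mulmxA mulmxK // !(mulmxDl, mulmxDr, mulNmx, mulmxN) !mulmxA addrC
  [- _ + _]addrC addrA [_ + (_ - _)]addrCA addrA.
Qed.

(** * Zero curvature for block matrices *)

(** Decides identities of noncommutative polynomials in matrices: once products are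
distributed and reassociated, each monomial has entries that [ring] can treat as
atoms. *)
Ltac nc_ring :=
  rewrite ?(mulmxDl, mulmxDr, mulNmx, mulmxN, mulmxA, scalerDr, scalerN, mul0mx, mulmx0,
    mul1mx, mulmx1, mul_scalar_mx, mul_mx_scalar) -?(scalemxAl, scalemxAr) ?mulmxA;
  apply/matrixP => ? ?; rewrite !mxE; ring.

Section BlockZeroCurvature.
Context {C : numFieldType} {n : nat}.
Variables (P Q Th W1 W2 P' Q' : 'M[C]_n) (th0 t : C).

(* A1 + x (-E) + x^-1 A0 is the ungauged coefficient of dY/dx, primes stand for
   t-derivatives, and Z is the ungauged Bhat_1 plus the logarithmic derivative
   diag(W1, W2) of the gauge. *)
Local Notation E := (block_mx 0 0 0 1%:M : 'M[C]_(n + n)).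
Local Notation M := (P *m Q - Th).
Local Notation S := (Q *m P + th0%:M).
Local Notation M' := (P' *m Q + P *m Q').
Local Notation S' := (Q' *m P + Q *m P').
Local Notation A1 := (block_mx 0 M 1%:M t%:M).
Local Notation A0 := (col_mx (- P) 1%:M *m row_mx Q S).
Local Notation A1' := (block_mx 0 M' 0 1%:M).
Local Notation A0' := (col_mx (- P') 0 *m row_mx Q S + col_mx (- P) 1%:M *m row_mx Q' S').
Local Notation Z := (block_mx W1 (- M) (- 1%:M) W2).

(** The x^2 term is [E, E] = 0, and the x^1 term is [A1, E] - [E, Z]. The latter vanishes
because Bhat_1 is minus the off-diagonal part of A1 and diag(W1, W2) commutes with E. *)
Lemma curvature_expansion x : x != 0 ->
  let Ah := x *: - E + A1 + x^-1 *: A0 in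
  A1' + x^-1 *: A0' - E + (Ah *m (x *: E + Z) - (x *: E + Z) *m Ah)
  = block_mx 0 (M' + M *m W2 - W1 *m M + t *: M - P *m S) (W1 - t%:M - W2 - Q) 0
    + x^-1 *: (A0' + (A0 *m Z - Z *m A0)).
Proof.
move=> x0 /=.
have comE : A1 *m E - E *m A1 = E *m Z - Z *m E.
  rewrite !mulmx_block !opp_block_mx !add_block_mx.
  by rewrite !(mul0mx, mulmx0, mul1mx, mulmx1, add0r, addr0, oppr0, subr0, opprK, subrr).
have -> : block_mx 0 (M' + M *m W2 - W1 *m M + t *: M - P *m S) (W1 - t%:M - W2 - Q) 0
    = A1' - E + (A1 *m Z - Z *m A1) + (A0 *m E - E *m A0).
  rewrite mul_col_row !mulmx_block !opp_block_mx !add_block_mx.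
  congr block_mx; nc_ring.
move: A1 A0 A1' A0' Z (E) comE => a1 a0 a1' a0' z e /eqP.
rewrite -subr_eq0 => /eqP comE.
apply/eqP; rewrite -subr_eq0; apply/eqP.
rewrite -(scaler0 _ x) -comE.
rewrite !(mulmxDl, mulmxDr, mulNmx, mulmxN, scalerDr, scalerN) -!(scalemxAl, scalemxAr).
apply/matrixP => i j; rewrite !mxE; field.
exact: x0.
Qed.

(** With R = (Q, Q P + th0), Z acts on L = (-P; I) by L (P + W2) up to a term supported in
the upper block; this isolates the equation for R' in the column L. *)
Lemma pole_partE :
  A0' + (A0 *m Z - Z *m A0) =
  col_mx (- P) 1%:M *m (row_mx Q' S' + row_mx Q S *m Z - (P + W2) *m row_mx Q S)
  - col_mx (P' + P *m (P + W2) - W1 *m P - M) 0 *m row_mx Q S.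
Proof.
have ZL : Z *m col_mx (- P) 1%:M = col_mx (- P) 1%:M *m (P + W2)
    + col_mx (P *m (P + W2) - W1 *m P - M) 0.
  rewrite mul_block_col mul_col_mx add_col_mx; congr col_mx; nc_ring.
have -> : col_mx (P' + P *m (P + W2) - W1 *m P - M) 0 =
    col_mx P' 0 + col_mx (P *m (P + W2) - W1 *m P - M) (0 : 'M[C]_n).
  by rewrite add_col_mx addr0 !addrA.
have -> : col_mx (- P') (0 : 'M[C]_n) = - col_mx P' 0 by rewrite opp_col_mx oppr0.
rewrite [Z *m _]mulmxA ZL.
nc_ring.
Qed.

(** The lower block gives the equation for R'; the upper block then gives e3 R = 0, and
multiplying by L on the right gives th0 e3 = 0, as R L = th0. *)
Lemma pole_part_eq0 : th0 != 0 ->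
  A0' + (A0 *m Z - Z *m A0) = 0 <->
  row_mx Q' S' + row_mx Q S *m Z - (P + W2) *m row_mx Q S = 0
  /\ P' + P *m (P + W2) - W1 *m P - M = 0.
Proof.
move=> th0N0; rewrite pole_partE; split => [|[-> ->]]; last first.
  by rewrite col_mx0 mulmx0 mul0mx subrr.
rewrite !mul_col_mx mul0mx mul1mx opp_col_mx add_col_mx oppr0 addr0.
move: (row_mx Q' _ + _ - _) (P' + _ - _ - _) => e2 e3.
rewrite -col_mx0 => /eq_col_mx[+ e20].
(* [col_mx P (- 1)] is - L. *)
rewrite e20 mulmx0 add0r => /(congr1 (mulmxr (col_mx P (- 1%:M)))) /=.
rewrite mul0mx mulNmx -mulmxA mul_row_col mulmxN mulmx1 opprD addrA subrr add0r.
rewrite mulmxN opprK mul_mx_scalar => /eqP.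
by rewrite scaler_eq0 (negPf th0N0) => /eqP.
Qed.

(** The equations for (P Q)' and (Q P)' are consequences of the three listed ones, which
uses that W1 commutes with Th: the (1,2) block of the x^0 term reduces to [W1, Th]. *)
Lemma zero_curvature_blocks : th0 != 0 -> W1 *m Th = Th *m W1 ->
  (forall x : C, x != 0 ->
    let Ah := x *: - E + A1 + x^-1 *: A0 in
    A1' + x^-1 *: A0' - E + (Ah *m (x *: E + Z) - (x *: E + Z) *m Ah) = 0) <->
  [/\ W2 = W1 - Q - t%:M,
      Q' = P *m Q + Q *m P - Q *m Q - t *: Q + th0%:M + (W1 *m Q - Q *m W1) &
      P' = P *m Q + P *m Q - P *m P - Th + t *: P + (W1 *m P - P *m W1)].
Proof.
move=> th0N0 WTh.
pose K0 := block_mx 0 (M' + M *m W2 - W1 *m M + t *: M - P *m S) (W1 - t%:M - W2 - Q) 0.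
pose K1 := A0' + (A0 *m Z - Z *m A0).
have KE : (forall x : C, x != 0 ->
    let Ah := x *: - E + A1 + x^-1 *: A0 in
    A1' + x^-1 *: A0' - E + (Ah *m (x *: E + Z) - (x *: E + Z) *m Ah) = 0) <->
    K0 = 0 /\ K1 = 0.
  split=> [K|[k0 k1] x x0]; last first.
    by rewrite /= curvature_expansion // -/K0 -/K1 k0 k1 scaler0 addr0.
  (* The values at x = 1 and x = -1 already separate the two coefficients. *)
  have Kx x : x != 0 -> K0 + x^-1 *: K1 = 0.
    by move=> x0; rewrite -curvature_expansion //; exact: K.
  have := Kx _ (oner_neq0 _); have := Kx (-1).
  rewrite oppr_eq0 oner_eq0 => /(_ isT); rewrite invrN1 invr1.
  rewrite scaleN1r scale1r => /eqP; rewrite subr_eq0 => /eqP ->.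
  rewrite -mulr2n -scaler_nat => /eqP; rewrite scaler_eq0 pnatr_eq0 /=.
  by move=> /eqP.
rewrite KE pole_part_eq0 // /K0 {KE K0 K1}; split=> [[k0 [e2 e3]]|[-> eQ eP]].
  move: k0; rewrite -(block_mx0 _ _ _ _ _) => /eq_block_mx[_ _ k0 _].
  have W2E : W2 = W1 - Q - t%:M.
    apply/eqP; rewrite -subr_eq0 -oppr_eq0 -k0; apply/eqP; nc_ring.
  have eQ : Q' = P *m Q + Q *m P - Q *m Q - t *: Q + th0%:M + (W1 *m Q - Q *m W1).
    move: e2; rewrite W2E mul_row_block mul_mx_row opp_row_mx !add_row_mx -row_mx0.
    move=> /eq_row_mx[e2 _]; apply/eqP; rewrite -subr_eq0 -e2; apply/eqP; nc_ring.
  split=> //; apply/eqP; rewrite -subr_eq0 -e3 W2E; apply/eqP; nc_ring.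
split.
  rewrite -[RHS](block_mx0 _ _ _ _ _); congr block_mx; last by nc_ring.
  have <- : W1 *m Th - Th *m W1 = 0 by rewrite WTh subrr.
  rewrite eQ eP; nc_ring.
split; last by rewrite eP; nc_ring.
rewrite mul_row_block mul_mx_row opp_row_mx !add_row_mx -row_mx0; congr row_mx.
  by rewrite eQ; nc_ring.
by rewrite eQ eP; nc_ring.
Qed.

End BlockZeroCurvature.

(** * The Hamiltonian system in coordinates *)

Section TwoByTwo.
Context {C : numFieldType}.
Implicit Types (a b c d q p v w x t : C).

Lemma mx2_eqP a b c d a' b' c' d' :
  mx2 a b c d = mx2 a' b' c' d' <-> [/\ a = a', b = b', c = c' & d = d'].
Proof.
split=> [e|[-> -> -> ->] //].
by split; [have := congr1 (fun A : 'M_2 => A 0 0) e | have := congr1 (fun A : 'M_2 => A 0 1) e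
  | have := congr1 (fun A : 'M_2 => A 1 0) e | have := congr1 (fun A : 'M_2 => A 1 1) e];
  rewrite !mxE.
Qed.

Lemma mulmx_mx2 a b c d a' b' c' d' : mx2 a b c d *m mx2 a' b' c' d' =
  mx2 (a * a' + b * c') (a * b' + b * d') (c * a' + d * c') (c * b' + d * d').
Proof.
apply/matrixP => i j; rewrite !mxE !big_ord_recl big_ord0 !mxE /= addr0.
by case: (i == 0); case: (j == 0).
Qed.

Lemma add_mx2 a b c d a' b' c' d' : mx2 a b c d + mx2 a' b' c' d' =
  mx2 (a + a') (b + b') (c + c') (d + d').
Proof. by apply/matrixP => i j; rewrite !mxE; case: (i == 0); case: (j == 0). Qed.

Lemma opp_mx2 a b c d : - mx2 a b c d = mx2 (- a) (- b) (- c) (- d).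
Proof. by apply/matrixP => i j; rewrite !mxE; case: (i == 0); case: (j == 0). Qed.

Lemma scale_mx2 x a b c d : x *: mx2 a b c d = mx2 (x * a) (x * b) (x * c) (x * d).
Proof. by apply/matrixP => i j; rewrite !mxE; case: (i == 0); case: (j == 0). Qed.

Lemma scalar_mx2 x : x%:M = mx2 x 0 0 x.
Proof.
by apply/matrixP => -[[|[|//]] ?] [[|[|//]] ?]; rewrite !mxE /= ?mulr1n ?mulr0n.
Qed.

Lemma trace_mx2 a b c d : \tr (mx2 a b c d) = a + d.
Proof. by rewrite /mxtrace !big_ord_recl big_ord0 !mxE /= addr0. Qed.

Lemma det_mx2 a b c d : \det (mx2 a b c d) = a * d - b * c.
Proof.
rewrite (expand_det_row _ 0) !big_ord_recl big_ord0 /cofactor !det_mx11 !mxE /=.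
by rewrite expr0 expr1; ring.
Qed.

Definition mx2E := (mulmx_mx2, add_mx2, opp_mx2, scale_mx2, scalar_mx2).

Lemma HamE th0 th1 th2 q1 p1 q2 p2 t : Ham th0 th1 th2 q1 p1 q2 p2 t =
  2 * q1 * (p1 ^+ 2 / 4 - p2 * (p2 * q2 - (th0 + th1 + th2)))
  + p1 * (2 * p2 * q2 - (th0 + th1 + th2)) - p1 * (q1 ^+ 2 - q2)
  - (2 * q1 + t) * (2 * p2 * q2 - (th0 + th1 + th2)) - t * p1 * q1
  + th0 * p1 - 2 * (th0 + th1) * q1.
Proof. by rewrite /Ham /Qmx /Pmx !mx2E trace_mx2; field. Qed.

(** The Hamiltonian has degree at most 2 in each of its variables. *)
Lemma derive1_quadratic (f : C -> C) a b c z :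
  (forall y, f y = a * y ^+ 2 + b * y + c) -> derive1 f z = 2 * a * z + b.
Proof.
move=> fE; rewrite derive1E.
have -> : f = a *: (id ^+ 2 : C -> C) + b *: (id : C -> C) + cst c.
  by apply/funext => y; rewrite fE.
have [_ ->] : is_derive z 1 (a *: (id ^+ 2 : C -> C) + b *: (id : C -> C) + cst c)
    (a *: (2%:R * z ^+ 1 *: 1) + b *: 1 + 0).
  apply: is_deriveD.
rewrite /GRing.scale /=; ring.
Qed.

Lemma Ham_q1 th0 th1 th2 q1 p1 q2 p2 t :
  derive1 (fun z => Ham th0 th1 th2 z p1 q2 p2 t) q1 =
  p1 ^+ 2 / 2 - 2 * p2 * (p2 * q2 - (th0 + th1 + th2)) - 2 * q1 * p1
  - 2 * (2 * p2 * q2 - (th0 + th1 + th2)) - t * p1 - 2 * (th0 + th1).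
Proof.
rewrite (@derive1_quadratic _ (- p1)
  (p1 ^+ 2 / 2 - 2 * p2 * (p2 * q2 - (th0 + th1 + th2))
   - 2 * (2 * p2 * q2 - (th0 + th1 + th2)) - t * p1 - 2 * (th0 + th1))
  (p1 * (2 * p2 * q2 - (th0 + th1 + th2)) + p1 * q2
   - t * (2 * p2 * q2 - (th0 + th1 + th2)) + th0 * p1)); first by field.
by move=> y; rewrite HamE; field.
Qed.

Lemma Ham_p1 th0 th1 th2 q1 p1 q2 p2 t :
  derive1 (fun z => Ham th0 th1 th2 q1 z q2 p2 t) p1 =
  q1 * p1 + 2 * p2 * q2 - (th0 + th1 + th2) - q1 ^+ 2 + q2 - t * q1 + th0.
Proof.
rewrite (@derive1_quadratic _ (q1 / 2)
  (2 * p2 * q2 - (th0 + th1 + th2) - q1 ^+ 2 + q2 - t * q1 + th0)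
  (- (2 * q1 * p2 * (p2 * q2 - (th0 + th1 + th2)))
   - (2 * q1 + t) * (2 * p2 * q2 - (th0 + th1 + th2)) - 2 * (th0 + th1) * q1)).
  by field.
by move=> y; rewrite HamE; field.
Qed.

Lemma Ham_q2 th0 th1 th2 q1 p1 q2 p2 t :
  derive1 (fun z => Ham th0 th1 th2 q1 p1 z p2 t) q2 =
  - (2 * q1 * p2 ^+ 2) + 2 * p1 * p2 + p1 - 4 * q1 * p2 - 2 * t * p2.
Proof.
rewrite (@derive1_quadratic _ 0
  (- (2 * q1 * p2 ^+ 2) + 2 * p1 * p2 + p1 - 4 * q1 * p2 - 2 * t * p2)
  (Ham th0 th1 th2 q1 p1 0 p2 t)); first by ring.
by move=> y; rewrite !HamE; field.
Qed.

Lemma Ham_p2 th0 th1 th2 q1 p1 q2 p2 t :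
  derive1 (fun z => Ham th0 th1 th2 q1 p1 q2 z t) p2 =
  - (2 * q1 * (2 * p2 * q2 - (th0 + th1 + th2))) + 2 * p1 * q2 - 4 * q1 * q2
  - 2 * t * q2.
Proof.
rewrite (@derive1_quadratic _ (- (2 * q1 * q2))
  (2 * q1 * (th0 + th1 + th2) + 2 * p1 * q2 - 4 * q1 * q2 - 2 * t * q2)
  (Ham th0 th1 th2 q1 p1 q2 0 t)); first by ring.
by move=> y; rewrite !HamE; field.
Qed.

(** The (1,2) entry of the equation for Q' has left-hand side 0 and determines w. With w
known, the (1,1) and (2,1) entries give q1' and q2', and the (1,1) and (1,2) entries of
the equation for P' give p1' and p2'. In each equation the two diagonal entries
agree, for P' because of the relation between the exponents, and the (2,1) entry for P'
follows from the others. *)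
Lemma matrix_hamilton_equations th0 th1 th2 th3 q1 p1 q2 p2 t w dq1 dp1 dq2 dp2 :
  2 * th0 + 2 * th1 + th2 + th3 = 0 ->
  let Q := Qmx q1 q2 in
  let P := Pmx th0 th1 th2 p1 q2 p2 in
  let W1 := mx2 0 0 0 w in
  (mx2 dq1 0 (- dq2) dq1 =
     P *m Q + Q *m P - Q *m Q - t *: Q + th0%:M + (W1 *m Q - Q *m W1) /\
   mx2 (dp1 / 2) (- dp2) (dp2 * q2 + p2 * dq2) (dp1 / 2) =
     P *m Q + P *m Q - P *m P - Theta th2 th3 + t *: P + (W1 *m P - P *m W1)) <->
  [/\ dq1 = derive1 (fun z => Ham th0 th1 th2 q1 z q2 p2 t) p1
        /\ dp1 = - derive1 (fun z => Ham th0 th1 th2 z p1 q2 p2 t) q1,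
      dq2 = derive1 (fun z => Ham th0 th1 th2 q1 p1 q2 z t) p2
        /\ dp2 = - derive1 (fun z => Ham th0 th1 th2 q1 p1 z p2 t) q2
    & w = p1 - 2 * (p2 + 1) * q1 - t].
Proof.
move=> hth Q P W1; rewrite Ham_q1 Ham_p1 Ham_q2 Ham_p2.
have -> : th3 = - (2 * th0 + 2 * th1 + th2).
  by apply/eqP; rewrite -addr_eq0 addrC hth.
rewrite /Q /P /W1 /Qmx /Pmx /Theta !mx2E !mx2_eqP; split.
  move=> [[e1 e2 e3 e4] [f1 f2 f3 f4]].
  have ew : w = p1 - 2 * (p2 + 1) * q1 - t.
    by apply/eqP; rewrite -subr_eq0 -oppr_eq0 [X in _ == X]e2; apply/eqP; field.
  split=> //; split.
  - by rewrite e1; field.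
  - by rewrite -[dp1](@divfK _ 2) ?pnatr_eq0 // f1; field.
  - by rewrite -[dq2]opprK e3 ew; field.
  - by rewrite -[dp2]opprK f2 ew; field.
by move=> [[-> ->] [-> ->] ->]; split; split; field.
Qed.

End TwoByTwo.

(** * The Lax pair *)

Section LaxPair.
Context {C : numFieldType}.
Variables (th0 th1 th2 th3 : C) (q1 p1 q2 p2 v : C -> C) (U : C -> 'M[C]_2) (t : C).
Hypotheses (dq1 : derivable q1 t 1) (dp1 : derivable p1 t 1)
  (dq2 : derivable q2 t 1) (dp2 : derivable p2 t 1) (dv : derivable v t 1)
  (dU : forall i j, derivable (fun s => U s i j) t 1)
  (v_neq0 : \near t, v t != 0) (detU_neq0 : \near t, \det (U t) != 0).

Let Q s := Qmx (q1 s) (q2 s).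
Let P s := Pmx th0 th1 th2 (p1 s) (q2 s) (p2 s).
Let G s := gauge (v s) (U s).
Let Q' := mx2 (derive1 q1 t) 0 (- derive1 q2 t) (derive1 q1 t).
Let P' := mx2 (derive1 p1 t / 2) (- derive1 p2 t)
  (derive1 p2 t * q2 t + p2 t * derive1 q2 t) (derive1 p1 t / 2).
Let W1 := mx2 0 0 0 ((v t)^-1 * derive1 v t).
Let W2 := derive_mx1 U t *m invmx (U t).
Let M := P t *m Q t - Theta th2 th3.

Lemma gauge_unitmx : \near t, G t \in unitmx.
Proof.
apply: filterS2 v_neq0 detU_neq0 => s vs us.
by rewrite unitmxE unitfE /G /gauge det_ublock det_mx2 mulf_neq0 // mul1r mulr0 subr0.
Qed.

Lemma is_derive_Q : is_derive_mx Q t Q'.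
Proof.
apply: is_derive_mx2; try exact: derivable_is_derive.
by apply: is_deriveN; exact: derivable_is_derive.
Qed.

Lemma is_derive_P : is_derive_mx P t P'.
Proof.
have dp : is_derive t 1 (fun s => p1 s / 2) (derive1 p1 t / 2).
  have := is_deriveZ (2^-1) (derivable_is_derive dp1).
  rewrite /GRing.scale /= [derive1 p1 t / 2]mulrC.
  by under [X in _ -> is_derive _ _ X _]eq_fun do rewrite mulrC.
apply: is_derive_mx2 => //.
  by apply: is_deriveN; exact: derivable_is_derive.
have := is_deriveM (derivable_is_derive dp2) (derivable_is_derive dq2).
rewrite /GRing.scale /= => dpq.
have -> : derive1 p2 t * q2 t + p2 t * derive1 q2 t =
    p2 t * derive1 q2 t + q2 t * derive1 p2 t - 0 - 0 - 0 by ring.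
do 3!apply: is_deriveB => //; exact: is_derive_const.
Qed.

(** The logarithmic derivative G' G^-1 of the gauge is diag(W1, W2). *)
Lemma is_derive_gauge : is_derive_mx G t (block_mx W1 0 0 W2 *m G t).
Proof.
have vt := nbhs_singleton v_neq0.
have ut : U t \in unitmx by rewrite unitmxE unitfE (nbhs_singleton detU_neq0).
have -> : block_mx W1 0 0 W2 *m G t = block_mx (mx2 0 0 0 (derive1 v t)) 0 0 (derive_mx1 U t).
  rewrite /G /gauge mulmx_block !(mulmx0, mul0mx, addr0, add0r) mulmxKV //.
  by congr block_mx; rewrite mulmx_mx2; congr mx2; field.
apply: is_derive_block; [|exact: is_derive_mx_cst|exact: is_derive_mx_cst|
  exact: derivable_is_derive_mx].
by apply: is_derive_mx2; try exact: is_derive_const; exact: derivable_is_derive.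
Qed.

Let E : 'M[C]_(2 + 2) := block_mx 0 0 0 1%:M.
Let Ahat x s := x *: Ahat_infty2
  + Ahat_infty1 th0 th1 th2 th3 (q1 s) (p1 s) (q2 s) (p2 s) s
  + x^-1 *: Ahat_0 th0 th1 th2 (q1 s) (p1 s) (q2 s) (p2 s).
Let Ahat_infty1' : 'M[C]_(2 + 2) := block_mx 0 (P' *m Q t + P t *m Q') 0 1%:M.
Let Ahat_0' : 'M[C]_(2 + 2) := col_mx (- P') 0 *m row_mx (Q t) (Q t *m P t + th0%:M)
  + col_mx (- P t) 1%:M *m row_mx Q' (Q' *m P t + Q t *m P').

Lemma is_derive_Ahat x : is_derive_mx (Ahat x) t (Ahat_infty1' + x^-1 *: Ahat_0').
Proof.
have dP := is_derive_P; have dQ := is_derive_Q.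
have dPQ := is_derive_mxM dP dQ; have dQP := is_derive_mxM dQ dP.
have d1 := is_derive_block (is_derive_mx_cst (0 : 'M[C]_2) t)
  (is_derive_mxD dPQ (is_derive_mx_cst (- Theta th2 th3) t))
  (is_derive_mx_cst (1%:M : 'M[C]_2) t) (@is_derive_scalar_mx C 2 t).
have d0 := is_derive_mxM
  (is_derive_col (is_derive_mxN dP) (is_derive_mx_cst (1%:M : 'M[C]_2) t))
  (is_derive_row dQ (is_derive_mxD dQP (is_derive_mx_cst (th0%:M) t))).
have := is_derive_mxD (is_derive_mxD (is_derive_mx_cst (x *: Ahat_infty2) t) d1)
  (is_derive_mxZ (is_derive_const x^-1 t) d0).
by rewrite scale0r !add0r !addr0.
Qed.

(** Conjugation by G removes it from the condition, at the cost of the term diag(W1, W2)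
added to Bhat_1. *)
Lemma compatible_atE x :
  compatible_at
    (fun x s => Amx th0 th1 th2 th3 (q1 s) (p1 s) (q2 s) (p2 s) (v s) (U s) s x)
    (fun x s => Bmx th0 th1 th2 th3 (q1 s) (p1 s) (q2 s) (p2 s) (v s) (U s) x) x t <->
  let Ah := x *: - E + block_mx 0 M 1%:M t%:M
    + x^-1 *: (col_mx (- P t) 1%:M *m row_mx (Q t) (Q t *m P t + th0%:M)) in
  let Z := block_mx W1 (- M) (- 1%:M) W2 in
  Ahat_infty1' + x^-1 *: Ahat_0' - E
    + (Ah *m (x *: E + Z) - (x *: E + Z) *m Ah) = 0.
Proof.
have uG := gauge_unitmx; have uGt := nbhs_singleton uG.
have comE : E *m G t = G t *m E.
  rewrite /E /G /gauge !mulmx_block.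
  by rewrite !(mul0mx, mulmx0, mul1mx, mulmx1, add0r, addr0).
have conjE : E = invmx (G t) *m E *m G t by rewrite -mulmxA comE mulKmx.
rewrite /compatible_at.
rewrite (is_derive_mx_val (is_derive_conjmx (is_derive_Ahat x) is_derive_gauge uG)).
have dB : is_derive_mx (fun y => Bmx th0 th1 th2 th3 (q1 t) (p1 t) (q2 t) (p2 t)
    (v t) (U t) y) x E.
  have := is_derive_mxD (is_derive_mxZ (is_derive_id x 1) (is_derive_mx_cst E x))
    (is_derive_mx_cst (invmx (G t) *m Bhat_1 th0 th1 th2 th3 (q1 t) (p1 t) (q2 t) (p2 t)
       *m G t) x).
  by rewrite scale1r scaler0 !addr0.
rewrite (is_derive_mx_val dB).
have -> : Amx th0 th1 th2 th3 (q1 t) (p1 t) (q2 t) (p2 t) (v t) (U t) t x =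
  invmx (G t) *m Ahat x t *m G t by [].
have -> : Bmx th0 th1 th2 th3 (q1 t) (p1 t) (q2 t) (p2 t) (v t) (U t) x =
  invmx (G t) *m (x *: E + Bhat_1 th0 th1 th2 th3 (q1 t) (p1 t) (q2 t) (p2 t)) *m G t.
  by rewrite mulmxDr mulmxDl -scalemxAr -scalemxAl -conjE.
rewrite {1}conjE /=.
have -> : x *: - E + block_mx 0 M 1%:M t%:M
    + x^-1 *: (col_mx (- P t) 1%:M *m row_mx (Q t) (Q t *m P t + th0%:M)) = Ahat x t.
  by rewrite /Ahat /Ahat_infty2 /E opp_block_mx oppr0.
have -> : block_mx W1 (- M) (- 1%:M) W2 = block_mx W1 0 0 W2 +
    Bhat_1 th0 th1 th2 th3 (q1 t) (p1 t) (q2 t) (p2 t).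
  by rewrite /Bhat_1 add_block_mx !addr0 !add0r.
set Bh := Bhat_1 _ _ _ _ _ _ _ _; set W := block_mx W1 0 0 W2.
set A := Ahat x t; set A' := _ + _ *: Ahat_0'; set g := G t.
have -> : invmx g *m (A' + (A *m W - W *m A)) *m g - invmx g *m E *m g
  + (invmx g *m A *m g *m (invmx g *m (x *: E + Bh) *m g)
     - invmx g *m (x *: E + Bh) *m g *m (invmx g *m A *m g)) =
  invmx g *m (A' - E + (A *m (x *: E + (W + Bh)) - (x *: E + (W + Bh)) *m A)) *m g.
  rewrite !mulmxA !mulmxK // addrA.
  nc_ring.
split=> [/(congr1 (fun K => g *m K *m invmx g))|->]; last by rewrite mulmx0 mul0mx.
by rewrite !mulmxA mulmxV // mul1mx mulmxK // mulmx0 mul0mx.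
Qed.

(** The equations hold pointwise: those at t involve only the values and the first
derivatives of the functions at t. *)
Lemma compatible_iff : 2 * th0 + 2 * th1 + th2 + th3 = 0 -> th0 != 0 ->
  (forall x, x != 0 -> compatible_at
    (fun x s => Amx th0 th1 th2 th3 (q1 s) (p1 s) (q2 s) (p2 s) (v s) (U s) s x)
    (fun x s => Bmx th0 th1 th2 th3 (q1 s) (p1 s) (q2 s) (p2 s) (v s) (U s) x) x t) <->
  let H := Ham th0 th1 th2 in
  [/\ derive1 q1 t = derive1 (fun z => H (q1 t) z (q2 t) (p2 t) t) (p1 t)
        /\ derive1 p1 t = - derive1 (fun z => H z (p1 t) (q2 t) (p2 t) t) (q1 t),
      derive1 q2 t = derive1 (fun z => H (q1 t) (p1 t) (q2 t) z t) (p2 t)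
        /\ derive1 p2 t = - derive1 (fun z => H (q1 t) (p1 t) z (p2 t) t) (q2 t),
      derive_mx1 U t =
        mx2 (- q1 t - t) (- 1)
            (q2 t) (p1 t - (2 * p2 t + 3) * q1 t - 2 * t) *m U t
    & (v t)^-1 * derive1 v t = p1 t - 2 * (p2 t + 1) * q1 t - t].
Proof.
move=> hth th0_neq0.
have ut : U t \in unitmx by rewrite unitmxE unitfE (nbhs_singleton detU_neq0).
have W1Th : W1 *m Theta th2 th3 = Theta th2 th3 *m W1.
  by rewrite /W1 /Theta !mulmx_mx2; congr mx2; ring.
(* W1 - Q - t is the matrix of the linear system for U once v'/v is known. *)
have EU : (v t)^-1 * derive1 v t = p1 t - 2 * (p2 t + 1) * q1 t - t ->
  derive_mx1 U t = mx2 (- q1 t - t) (- 1)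
    (q2 t) (p1 t - (2 * p2 t + 3) * q1 t - 2 * t) *m U t <-> W2 = W1 - Q t - t%:M.
  move=> ew; have -> : W1 - Q t - t%:M = mx2 (- q1 t - t) (- 1)
    (q2 t) (p1 t - (2 * p2 t + 3) * q1 t - 2 * t).
    by rewrite /W1 ew /Q /Qmx !mx2E; congr mx2; ring.
  by rewrite /W2; split=> [->|<-]; rewrite ?mulmxK ?mulmxKV.
have blocks := zero_curvature_blocks (P t) (Q t) W2 P' Q' t th0_neq0 W1Th.
have entries := matrix_hamilton_equations (q1 t) (p1 t) (q2 t) (p2 t) t
  ((v t)^-1 * derive1 v t) (derive1 q1 t) (derive1 p1 t) (derive1 q2 t) (derive1 p2 t) hth.
split=> [comp|[eq1 eq2 eU ew]].
  have [eW2 eQ eP] := blocks.1 (fun x x0 => (compatible_atE x).1 (comp x x0)).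
  have [eq1 eq2 ew] := entries.1 (conj eQ eP).
  by split=> //; apply/(EU ew).
have [eQ eP] : _ /\ _ := entries.2 (And3 eq1 eq2 ew).
have zero := blocks.2 (And3 ((EU ew).1 eU) eQ eP).
by move=> x x0; apply/compatible_atE; exact: zero.
Qed.

End LaxPair.

Theorem mainTheorem4 (R : realType) (th0 th1 th2 th3 : Cplx R)
    (hth : 2 * th0 + 2 * th1 + th2 + th3 = 0)
    (hth0 : th0 != 0) (hth23 : th2 != th3)
    (D : set (Cplx R)) (hD : complex_domain D)
    (q1 p1 q2 p2 v : Cplx R -> Cplx R) (U : Cplx R -> 'M[Cplx R]_2)
    (hq1 : holomorphic_on D q1) (hp1 : holomorphic_on D p1)
    (hq2 : holomorphic_on D q2) (hp2 : holomorphic_on D p2)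
    (hv : holomorphic_on D v) (hU : holomorphic_mx_on D U)
    (hv0 : forall t, D t -> v t != 0)
    (hU0 : forall t, D t -> \det (U t) != 0) :
  let A := fun x t : Cplx R =>
    Amx th0 th1 th2 th3 (q1 t) (p1 t) (q2 t) (p2 t) (v t) (U t) t x in
  let B := fun x t : Cplx R =>
    Bmx th0 th1 th2 th3 (q1 t) (p1 t) (q2 t) (p2 t) (v t) (U t) x in
  let H := Ham th0 th1 th2 in
  (forall t, D t -> forall x, x != 0 -> compatible_at A B x t)
  <->
  (forall t, D t ->
    [/\ derive1 q1 t = derive1 (fun z => H (q1 t) z (q2 t) (p2 t) t) (p1 t)
          /\ derive1 p1 t = - derive1 (fun z => H z (p1 t) (q2 t) (p2 t) t) (q1 t),
        derive1 q2 t = derive1 (fun z => H (q1 t) (p1 t) (q2 t) z t) (p2 t)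
          /\ derive1 p2 t = - derive1 (fun z => H (q1 t) (p1 t) z (p2 t) t) (q2 t),
        derive_mx1 U t =
          mx2 (- q1 t - t) (- 1)
              (q2 t) (p1 t - (2 * p2 t + 3) * q1 t - 2 * t) *m U t
      & (v t)^-1 * derive1 v t = p1 t - 2 * (p2 t + 1) * q1 t - t]).
Proof.
have [openD _ _] := hD.
have nearD (S : set (Cplx R)) t : (forall s, D s -> S s) -> D t -> \near t, S t.
  by move=> DS Dt; apply: filterS DS (open_nbhs_nbhs (conj openD Dt)).
have pointwise t (Dt : D t) := compatible_iff (hq1 t Dt) (hp1 t Dt) (hq2 t Dt)
  (hp2 t Dt) (hv t Dt) (fun i j => hU i j t Dt) (nearD _ t hv0 Dt) (nearD _ t hU0 Dt)
  hth hth0.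
by move=> A B H; split=> eqs t Dt; apply/(pointwise t Dt); exact: eqs.
Qed.
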